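(* The manifold of all probability distributions over a finite set is a Monge--Ampère manifold.
   Context: The manifold of all (strictly positive) probability distributions $p$ over a finite set $\Omega$ is the open simplex $\{p:\ 0<p(\omega)<1 \text{ for all } \omega\in\Omega,\ \sum_{\omega\in\Omega}p(\omega)=1\}$, equipped with its Fisher metric $g$ and its dual pair of affine connections, for which it is a dually flat manifold: $g$ is a Riemannian metric and $\nabla,\nabla^*$ are flat torsion-free connections with $Xg(Y,Z)=g(\nabla_XY,Z)+g(Y,\nabla^*_XZ)$. A potential function of the metric is a function $\Phi$ with $g_{ij}=\partial_i\partial_j\Phi$ in affine coordinates of $\nabla$ (respectively, $g^{ij}=\partial^i\partial^j\Phi$ in dual affine coordinates of $\nabla^*$). A Monge--Ampère equation is an equation $\det\mathrm{Hess}(\Phi)=f$ for a smooth convex function $\Phi$ on a domain, with $f$ a nonnegative function; no boundary condition is imposed. A Monge--Ampère manifold is a manifold on which, everywhere locally, there is a smooth potential function $\Phi$ satisfying a Monge--Ampère equation. *)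

(* Defs.v *)
From HB Require Import structures.
From mathcomp Require Import all_boot all_order all_algebra.
From mathcomp Require Import all_classical all_reals all_analysis.
From mathcomp Require Import ring.
Set Implicit Arguments.
Unset Strict Implicit.
Unset Printing Implicit Defensive.
Import Order.TTheory GRing.Theory Num.Theory.
Import numFieldNormedType.Exports.
Local Open Scope classical_set_scope.
Local Open Scope ring_scope.

Section Smoothness.
Context {R : realType} {E W : normedModType R}.

Definition iter_derive (vs : seq E) (f : E -> W) : E -> W :=
  foldr (fun v h => 'D_v h) f vs.

(* [U] is relatively open in the union of the affine subspaces with direction
   space [T] that meet it *)
Definition affine_open (T U : set E) : Prop :=
  forall p, U p -> \forall u \near (0 : E), T u -> U (p + u).

(* C^oo along [T] on an [affine_open T] set: only the values of [f] on [U] matter *)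
Definition smooth_on (T U : set E) (f : E -> W) : Prop :=
  forall vs : seq E, (forall v, v \in vs -> T v) ->
    {within U, continuous (iter_derive vs f)} /\
    (forall p v, U p -> T v -> derivable (iter_derive vs f) p v).

End Smoothness.

Section Connections.
Context {R : realType} {E : normedModType R}.

(* The covariant derivative D + B, where D is the flat connection of the ambient
   affine space and B the difference tensor *)
Definition nabla (B : E -> E -> E -> E) (X Y : E -> E) : E -> E :=
  fun p => 'D_(X p) Y p + B p (X p) (Y p).

End Connections.

(* Dually flat manifolds (points, metric, conn, dual_conn) presented as
   relatively open subsets of a finite-dimensional affine subspace of [E], all
   of whose tangent spaces are then the direction space [dirs].  The tensor
   identities (vanishing torsion and curvature, duality) are stated on the
   constant vector fields, which commute and span every tangent space. *)
Record dually_flat_manifold (R : realType) (E : normedModType R) :=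
  DuallyFlatManifold {
  dim : nat;
  points : set E;
  dirs : set E;
  metric : E -> E -> E -> R;
  conn : E -> E -> E -> E;
  dual_conn : E -> E -> E -> E;
  dirs_basis : exists b : 'I_dim -> E,
    dirs = [set v | exists c : 'I_dim -> R, v = \sum_i c i *: b i] /\
    (forall c : 'I_dim -> R, \sum_i c i *: b i = 0 -> forall i, c i = 0);
  points_affine : forall p q, points p -> points q -> dirs (q - p);
  points_open : affine_open dirs points;
  metric_smooth : forall u v, dirs u -> dirs v ->
    smooth_on dirs points (fun p => metric p u v);
  metric_sym : forall p u v, points p -> dirs u -> dirs v ->
    metric p u v = metric p v u;
  metric_linear : forall p a u v w, points p -> dirs u -> dirs v -> dirs w ->
    metric p (a *: u + v) w = a * metric p u w + metric p v w;
  metric_pos : forall p u, points p -> dirs u -> u != 0 -> 0 < metric p u u;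
  conn_dirs : forall B, B = conn \/ B = dual_conn ->
    forall p u v, points p -> dirs u -> dirs v -> dirs (B p u v);
  conn_smooth : forall B, B = conn \/ B = dual_conn ->
    forall u v, dirs u -> dirs v -> smooth_on dirs points (fun p => B p u v);
  conn_linear : forall B, B = conn \/ B = dual_conn ->
    forall p a u v w, points p -> dirs u -> dirs v -> dirs w ->
    B p (a *: u + v) w = a *: B p u w + B p v w /\
    B p w (a *: u + v) = a *: B p w u + B p w v;
  conn_torsion_free : forall B, B = conn \/ B = dual_conn ->
    forall p u v, points p -> dirs u -> dirs v ->
    nabla B (cst u) (cst v) p = nabla B (cst v) (cst u) p;
  conn_flat : forall B, B = conn \/ B = dual_conn ->
    forall p u v w, points p -> dirs u -> dirs v -> dirs w ->
    nabla B (cst u) (nabla B (cst v) (cst w)) p =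
    nabla B (cst v) (nabla B (cst u) (cst w)) p;
  conn_dual : forall p u v w, points p -> dirs u -> dirs v -> dirs w ->
    'D_u (fun q => metric q v w) p =
    metric p (nabla conn (cst u) (cst v) p) w +
    metric p v (nabla dual_conn (cst u) (cst w) p)
}.

Section MongeAmpere.
Context {R : realType}.

Definition partial {W : normedModType R} (n : nat) (i : 'I_n)
  (f : 'rV[R]_n -> W) : 'rV[R]_n -> W := 'D_(delta_mx 0 i) f.

Definition hess (n : nat) (f : 'rV[R]_n -> R) (x : 'rV[R]_n) : 'M[R]_n :=
  \matrix_(i, j) partial i (partial j f) x.

Definition satisfies_monge_ampere (n : nat) (V : set 'rV[R]_n)
    (Phi : 'rV[R]_n -> R) : Prop :=
  [/\ open V, convex_set V, smooth_on setT V Phi, convex_function V Phi &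
    exists f : 'rV[R]_n -> R,
      (forall x, V x -> 0 <= f x) /\ (forall x, V x -> \det (hess Phi x) = f x)].

Context {E : normedModType R} (M : dually_flat_manifold E).
Local Notation n := (dim M).

(* Local coordinates [x : U -> V] on [M], with inverse [psi : V -> U] *)
Definition coordinate_chart (U : set E) (x : E -> 'rV[R]_n)
    (V : set 'rV[R]_n) (psi : 'rV[R]_n -> E) : Prop :=
  [/\ U `<=` points M, affine_open (dirs M) U & open V] /\
  [/\ (forall p, U p -> V (x p) /\ psi (x p) = p),
      (forall y, V y -> U (psi y) /\ x (psi y) = y),
      smooth_on (dirs M) U x & smooth_on setT V psi].

(* nabla_{d_i} d_j = 0, for the coordinate vector fields d_j = partial j psi *)
Definition affine_coordinates (B : E -> E -> E -> E)
    (V : set 'rV[R]_n) (psi : 'rV[R]_n -> E) : Prop :=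
  forall y i j, V y ->
    partial i (partial j psi) y +
    B (psi y) (partial i psi y) (partial j psi y) = 0.

Definition metric_mx (psi : 'rV[R]_n -> E) (y : 'rV[R]_n) : 'M[R]_n :=
  \matrix_(i, j) metric M (psi y) (partial i psi y) (partial j psi y).

Definition metric_potential (V : set 'rV[R]_n) (psi : 'rV[R]_n -> E)
    (Phi : 'rV[R]_n -> R) : Prop :=
  forall y, V y -> metric_mx psi y = hess Phi y.

Definition locally_monge_ampere (B : E -> E -> E -> E) : Prop :=
  forall p, points M p ->
    exists (U : set E) (x : E -> 'rV[R]_n) (V : set 'rV[R]_n)
           (psi : 'rV[R]_n -> E) (Phi : 'rV[R]_n -> R),
      [/\ U p, coordinate_chart U x V psi, affine_coordinates B V psi,
          metric_potential V psi Phi & satisfies_monge_ampere V Phi].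

(* For [dual_conn] the metric coefficients in affine coordinates dual to
   [conn]-affine ones are the g^{ij}, so this covers both kinds of potential *)
Definition monge_ampere_manifold : Prop :=
  locally_monge_ampere (conn M) /\ locally_monge_ampere (dual_conn M).

End MongeAmpere.

(* A function on [Omega] is encoded as a row vector indexed through [enum_rank] *)
Definition at_pt (R : realType) (Omega : finType) (p : 'rV[R]_#|Omega|)
  (w : Omega) : R := p 0 (enum_rank w).

HB.lock Definition score (R : realType) (Omega : finType)
  (p u : 'rV[R]_#|Omega|) (w : Omega) : R := 'D_u (fun q => ln (at_pt q w)) p.

Section ProbabilityManifold.
Context (R : realType) (Omega : finType).
Local Notation E := 'rV[R]_#|Omega|.
Implicit Types (p q u v : E) (w : Omega).

Definition open_simplex : set E :=
  [set p | (forall w, 0 < at_pt p w < 1) /\ \sum_w at_pt p w = 1].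

Definition sum_zero : set E := [set u | \sum_w at_pt u w = 0].

Definition expect p (f : Omega -> R) : R := \sum_w at_pt p w * f w.

(* Fisher information E_p[(d_u log p) (d_v log p)] *)
Definition fisher p u v : R := expect p (fun w => score p u w * score p v w).

(* Connections are given by their difference tensors from D, as in [nabla] *)
Definition mixture_conn p u v : E := 0.

(* The exponential connection differentiates scores: the score of nabla_u Y is the
   derivative along u of the score of Y, minus its expectation *)
Definition exponential_conn p u v : E :=
  \row_i let s := fun w => score p u w * score p v w in
    - (at_pt p (enum_val i) * (s (enum_val i) - expect p s)).

Definition positive : set E := [set p | forall w, 0 < at_pt p w].

Lemma at_ptE a p q w : at_pt (a *: p + q) w = a * at_pt p w + at_pt q w.
Proof. by rewrite /at_pt !mxE. Qed.

Lemma at_ptP p q : (forall w, at_pt p w = at_pt q w) -> p = q.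
Proof.
by move=> pq; apply/rowP => i; have := pq (enum_val i); rewrite /at_pt enum_valK.
Qed.

Lemma at_pt_row (f : 'I_#|Omega| -> R) w : at_pt (\row_i f i) w = f (enum_rank w).
Proof. by rewrite /at_pt mxE. Qed.

Lemma at_pt_continuous w : continuous (fun p => at_pt p w).
Proof. exact: coord_continuous. Qed.

Lemma at_pt_derive p u w : is_derive p u (fun q => at_pt q w) (at_pt u w).
Proof.
have /derivable_mxP d := @derivable_id _ E p u.
apply: DeriveDef; first exact: d.
have /derive_mx := @derivable_id _ E p u.
rewrite derive_id => /matrixP /(_ 0 (enum_rank w)).
by rewrite mxE /= => <-.
Qed.

Lemma near_positive p : positive p -> \forall q \near p, positive q.
Proof.
move=> pp.
have := @filter_forall _ Omega (fun w q => 0 < at_pt q w) (nbhs p) _.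
apply => w; exact: cvgr_gt (at_pt_continuous (w := w) (x := p)) _ (pp w).
Qed.

Lemma simplex_positive p : open_simplex p -> positive p.
Proof. by case=> p01 _ w; case/andP: (p01 w). Qed.

Lemma scoreE p u w : 0 < at_pt p w -> score p u w = at_pt u w / at_pt p w.
Proof.
move=> pw; rewrite unlock.
have -> : 'D_u (fun q => ln (at_pt q w)) p =
          'D_1 (fun h : R => ln (h * at_pt u w + at_pt p w)) 0.
  rewrite /derive; set g1 := fun h => h^-1 *: _; set g2 := fun h => h^-1 *: _.
  suff -> : g1 = g2 by [].
  rewrite funeqE /g1 /g2 => h /=.
  by rewrite !at_ptE addr0 mul0r add0r [h%:A]mulr1.
have dl : is_derive (0 : R) 1 ((id : R -> R) * cst (at_pt u w) + cst (at_pt p w))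
    (at_pt u w).
  have := is_deriveD (is_deriveM (is_derive_id (0 : R) 1)
    (is_derive_cst (at_pt u w : R) (0 : R) 1)) (is_derive_cst (at_pt p w : R) (0 : R) 1).
  by move/is_derive_eq; apply; rewrite addr0 scaler0 add0r; exact: mulr1.
have dln : is_derive (0 * at_pt u w + at_pt p w) 1 (@ln R) (at_pt p w)^-1.
  by rewrite mul0r add0r; exact: is_derive1_ln.
have [_ h] := @is_derive1_comp R (@ln R)
  ((id : R -> R) * cst (at_pt u w) + cst (at_pt p w)) 0 _ _ dln dl.
by rewrite [RHS]mulrC; exact: h.
Qed.

(* Rational functions of the probabilities, a class closed under derivation *)
Inductive ratfun :=
  | Rcst of R | Rvar of Omega | Rinv of Omega
  | Radd of ratfun & ratfun | Rmul of ratfun & ratfun.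

Fixpoint reval (e : ratfun) (p : E) : R :=
  match e with
  | Rcst a => a
  | Rvar w => at_pt p w
  | Rinv w => (at_pt p w)^-1
  | Radd e1 e2 => reval e1 p + reval e2 p
  | Rmul e1 e2 => reval e1 p * reval e2 p
  end.

Fixpoint rderiv (u : E) (e : ratfun) : ratfun :=
  match e with
  | Rcst a => Rcst 0
  | Rvar w => Rcst (at_pt u w)
  | Rinv w => Rmul (Rcst (- at_pt u w)) (Rmul (Rinv w) (Rinv w))
  | Radd e1 e2 => Radd (rderiv u e1) (rderiv u e2)
  | Rmul e1 e2 => Radd (Rmul (rderiv u e1) e2) (Rmul e1 (rderiv u e2))
  end.

Definition rsum (f : Omega -> ratfun) : ratfun :=
  foldr (fun w e => Radd (f w) e) (Rcst 0) (index_enum Omega).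

Lemma rsumE f p : reval (rsum f) p = \sum_w reval (f w) p.
Proof.
rewrite /rsum; elim: (index_enum _) => [|w s IH]; first by rewrite big_nil.
by rewrite big_cons /= IH.
Qed.

Lemma rderiv_sumE u f p : reval (rderiv u (rsum f)) p = \sum_w reval (rderiv u (f w)) p.
Proof.
rewrite /rsum; elim: (index_enum _) => [|w s IH]; first by rewrite big_nil.
by rewrite big_cons /= IH.
Qed.

Lemma reval_derive e p u : positive p ->
  is_derive p u (reval e) (reval (rderiv u e) p).
Proof.
move=> pp; elim: e => [a|w|w|e1 d1 e2 d2|e1 d1 e2 d2] /=.
- exact: is_derive_cst.
- exact: at_pt_derive.
- have p0 : at_pt p w != 0 by rewrite gt_eqF.
  have [d de] := at_pt_derive p u w.
  apply: DeriveDef; first exact: derivableV.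
  by rewrite deriveV // de /GRing.scale /=; field.
-
  by have := is_deriveD d1 d2.
- have := is_deriveM d1 d2; move/is_derive_eq; apply.
  by rewrite /GRing.scale /= addrC; congr (_ + _); rewrite mulrC.
Qed.

Lemma reval_continuous e p : positive p -> {for p, continuous (reval e)}.
Proof.
move=> pp; suff : reval e q @[q --> nbhs p] --> reval e p by [].
elim: e => [a|w|w|e1 d1 e2 d2|e1 d1 e2 d2] /=.
- exact: cvg_cst.
- exact: at_pt_continuous.
- by apply: cvgV; [rewrite gt_eqF | exact: at_pt_continuous].
- by apply: cvgD.
- by apply: cvgM.
Qed.

Lemma near_eq_continuous (W : normedModType R) (f g : E -> W) p :
  (\forall q \near p, f q = g q) -> {for p, continuous g} -> {for p, continuous f}.
Proof.
move=> fg cg; have fgp : f p = g p by exact: nbhs_singleton fg.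
rewrite /prop_for /continuous_at fgp; apply: cvg_trans cg.
by apply: (@near_eq_cvg _ _ (nbhs p)); apply: filterS fg => q ->.
Qed.

Lemma mx_continuous m (f : E -> 'rV[R]_m) p :
  (forall i, {for p, continuous (fun q => f q 0 i)}) -> {for p, continuous f}.
Proof.
move=> fi; suff : f q @[q --> nbhs p] --> f p by [].
apply/cvgrPdist_le => /= e e0.
near=> x.
rewrite /Num.Def.normr/= mx_normrE (bigmax_le _ (ltW e0))//= => -[i j] _.
rewrite !mxE/= ord1.
move: j; near: x; apply: filter_forall => j.
have /cvgrPdist_le : f q 0 j @[q --> nbhs p] --> f p 0 j by exact: fi.
exact.
Unshelve. all: by end_near. Qed.

Definition rrow (e : 'I_#|Omega| -> ratfun) p : E := \row_i reval (e i) p.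

Lemma rrow_derive e p u : positive p ->
  is_derive p u (rrow e) (rrow (fun i => rderiv u (e i)) p).
Proof.
move=> pp.
have d : derivable (rrow e) p u.
  apply/derivable_mxP => i j; have [d _] := reval_derive (e j) u pp.
  by under eq_fun do rewrite mxE.
apply: DeriveDef => //; rewrite derive_mx //; apply/rowP => j; rewrite !mxE.
under eq_fun do rewrite mxE.
by have [_ ->] := reval_derive (e j) u pp.
Qed.

Lemma rrow_continuous e p : positive p -> {for p, continuous (rrow e)}.
Proof.
move=> pp; apply: mx_continuous => i.
rewrite (_ : (fun q => rrow e q 0 i) = reval (e i)).
  exact: reval_continuous.
by apply/funext => q; rewrite mxE.
Qed.

Lemma smooth_on_class (W : normedModType R) (I : Type) (ev : I -> E -> W)
    (der : E -> I -> I) (f : E -> W) (e : I) (T U : set E) :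
  (forall e p u, positive p -> is_derive p u (ev e) (ev (der u e) p)) ->
  (forall e p, positive p -> {for p, continuous (ev e)}) ->
  U `<=` positive -> (forall p, positive p -> f p = ev e p) -> smooth_on T U f.
Proof.
move=> evD evC Up fe vs _.
have fvs p : positive p -> iter_derive vs f p = ev (foldr der e vs) p.
  elim: vs p => [|v vs IH] p pp /=; first exact: fe.
  have [_ <-] := evD (foldr der e vs) p v pp.
  apply: near_eq_derive; have := near_positive pp.
  by apply: filterS => q /IH.
have nfvs p : positive p ->
    \forall q \near p, iter_derive vs f q = ev (foldr der e vs) q.
  by move=> /near_positive; apply: filterS => q /fvs.
split=> [|p v /Up pp _].
  apply: continuous_in_subspaceT => p /set_mem /Up pp.
  exact: near_eq_continuous (nfvs p pp) (evC _ p pp).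
have [d _] := evD (foldr der e vs) p v pp.
apply: near_eq_derivable d; have := nfvs p pp.
by apply: filterS => q ->.
Qed.

Lemma fisherE p u v : positive p ->
  fisher p u v = \sum_w at_pt u w * at_pt v w / at_pt p w.
Proof.
move=> pp; apply: eq_bigr => w _; rewrite !scoreE //.
by field; rewrite gt_eqF ?pp.
Qed.

Lemma exponential_conn_at p u v w : at_pt (exponential_conn p u v) w =
  - (at_pt p w * (score p u w * score p v w - fisher p u v)).
Proof. by rewrite at_pt_row /= enum_rankK. Qed.

Lemma exponential_connE p u v w : positive p ->
  at_pt (exponential_conn p u v) w =
  at_pt p w * fisher p u v - at_pt u w * at_pt v w / at_pt p w.
Proof.
move=> pp; rewrite exponential_conn_at !scoreE //.
by field; rewrite gt_eqF ?pp.
Qed.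

Definition fisher_ratfun u v : ratfun :=
  rsum (fun w => Rmul (Rcst (at_pt u w * at_pt v w)) (Rinv w)).

Lemma fisher_ratfunE p u v : positive p -> fisher p u v = reval (fisher_ratfun u v) p.
Proof. by move=> pp; rewrite fisherE // rsumE. Qed.

Definition exponential_ratfun u v (i : 'I_#|Omega|) : ratfun :=
  let w := enum_val i in
  Radd (Rmul (Rvar w) (fisher_ratfun u v))
       (Rmul (Rcst (- (at_pt u w * at_pt v w))) (Rinv w)).

Lemma exponential_ratfunE p u v : positive p ->
  exponential_conn p u v = rrow (exponential_ratfun u v) p.
Proof.
move=> pp; apply: at_ptP => w.
by rewrite exponential_connE // at_pt_row /= enum_rankK -fisher_ratfunE // mulNr.
Qed.

Lemma fisher_smooth u v : smooth_on sum_zero open_simplex (fun p => fisher p u v).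
Proof.
apply: (smooth_on_class (e := fisher_ratfun u v) reval_derive reval_continuous).
- exact: simplex_positive.
- by move=> p; exact: fisher_ratfunE.
Qed.

Lemma exponential_conn_smooth u v :
  smooth_on sum_zero open_simplex (fun p => exponential_conn p u v).
Proof.
apply: (smooth_on_class (e := exponential_ratfun u v) rrow_derive rrow_continuous).
- exact: simplex_positive.
- by move=> p; exact: exponential_ratfunE.
Qed.

Lemma mixture_conn_smooth u v :
  smooth_on sum_zero open_simplex (fun p => mixture_conn p u v).
Proof.
apply: (smooth_on_class (e := fun=> Rcst 0) rrow_derive rrow_continuous).
- exact: simplex_positive.
- by move=> p _; apply: at_ptP => w; rewrite at_pt_row /at_pt mxE.
Qed.


Lemma sum_zero_scale a u v : sum_zero u -> sum_zero v -> sum_zero (a *: u + v).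
Proof.
rewrite /sum_zero /= => u0 v0.
under eq_bigr do rewrite at_ptE.
by rewrite big_split /= -mulr_sumr u0 v0 mulr0 addr0.
Qed.

Lemma simplex_dirs p q : open_simplex p -> open_simplex q -> sum_zero (q - p).
Proof.
move=> [_ p1] [_ q1]; rewrite /sum_zero /=.
rewrite (eq_bigr (fun w => at_pt q w - at_pt p w)); last by move=> w _; rewrite /at_pt !mxE.
by rewrite sumrB p1 q1 subrr.
Qed.

Lemma simplex_open : affine_open sum_zero open_simplex.
Proof.
move=> p [p01 p1].
have cadd w : at_pt (p + u) w @[u --> nbhs (0 : E)] --> at_pt p w.
  rewrite (_ : (fun u => at_pt (p + u) w) = (fun u => at_pt p w + at_pt u w)).
    rewrite -[X in _ --> X]addr0; apply: cvgD; first exact: cvg_cst.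
    have := @at_pt_continuous w (0 : E).
    by rewrite /continuous_at {2}/at_pt mxE.
  by apply/funext => u; rewrite /at_pt mxE.
have near1 : \forall u \near (0 : E), forall w, 0 < at_pt (p + u) w < 1.
  have := @filter_forall _ Omega (fun w u => 0 < at_pt (p + u) w < 1) (nbhs (0 : E)) _.
  apply => w; have /andP[pw0 pw1] := p01 w.
  have h0 : \forall u \near (0 : E), 0 < at_pt (p + u) w.
    exact: cvgr_gt (cadd w) _ pw0.
  have h1 : \forall u \near (0 : E), at_pt (p + u) w < 1.
    exact: cvgr_lt (cadd w) _ pw1.
  by move: h0 h1; apply: filterS2 => u -> ->.
move: near1; apply: filterS => u u01; rewrite /sum_zero /= => u0; split => //.
rewrite (eq_bigr (fun w => at_pt p w + at_pt u w)); last by move=> w _; rewrite /at_pt !mxE.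
by rewrite big_split /= p1 u0 addr0.
Qed.

Lemma fisher_sym p u v : positive p -> fisher p u v = fisher p v u.
Proof.
by move=> pp; rewrite !fisherE //; apply: eq_bigr => w _; rewrite [at_pt u w * _]mulrC.
Qed.

Lemma fisher_linear p a u v z : positive p ->
  fisher p (a *: u + v) z = a * fisher p u z + fisher p v z.
Proof.
move=> pp; rewrite !fisherE // mulr_sumr -big_split /=; apply: eq_bigr => w _ /=.
by rewrite at_ptE; field; rewrite gt_eqF ?pp.
Qed.

Lemma fisher_pos p u : positive p -> u != 0 -> 0 < fisher p u u.
Proof.
move=> pp u0; rewrite fisherE //.
have t0 w : 0 <= at_pt u w * at_pt u w / at_pt p w.
  by apply: divr_ge0; [rewrite -expr2 sqr_ge0 | exact: ltW].
rewrite lt0r sumr_ge0 ?andbT //; apply: contra u0 => /eqP s0.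
apply/eqP/at_ptP => w; rewrite [RHS]/at_pt mxE.
have /eqP := @psumr_eq0P _ _ xpredT _ (fun w _ => t0 w) s0 w isT.
by rewrite mulf_eq0 invr_eq0 (gt_eqF (pp w)) orbF mulf_eq0 orbb => /eqP.
Qed.

Lemma exponential_sym p u v : positive p ->
  exponential_conn p u v = exponential_conn p v u.
Proof.
move=> pp; apply: at_ptP => w.
by rewrite !(exponential_connE _ _ _ pp) (fisher_sym _ _ pp) [at_pt u w * _]mulrC.
Qed.

Lemma exponential_dirs p u v : open_simplex p -> sum_zero (exponential_conn p u v).
Proof.
move=> pS; have pp := simplex_positive pS; case: pS => _ p1.
rewrite /sum_zero /=; under eq_bigr do rewrite exponential_connE //.
by rewrite sumrB -mulr_suml p1 mul1r -fisherE // subrr.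
Qed.

Lemma exponential_linear p a u v z : positive p ->
  exponential_conn p (a *: u + v) z =
  a *: exponential_conn p u z + exponential_conn p v z.
Proof.
move=> pp; apply: at_ptP => w.
rewrite at_ptE !(exponential_connE _ _ _ pp) (fisher_linear _ _ _ _ pp) at_ptE.
by field; rewrite gt_eqF ?pp.
Qed.

Lemma nabla_cst (B : E -> E -> E -> E) u v : nabla B (cst u) (cst v) = fun p => B p u v.
Proof. by apply/funext => p; rewrite /nabla derive_cst add0r. Qed.

Lemma exponential_flat p u v z : open_simplex p ->
    sum_zero u -> sum_zero v -> sum_zero z ->
  nabla exponential_conn (cst u) (nabla exponential_conn (cst v) (cst z)) p =
  nabla exponential_conn (cst v) (nabla exponential_conn (cst u) (cst z)) p.
Proof.
move=> pS; have pp := simplex_positive pS.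
suff dE a b : sum_zero a -> sum_zero b ->
    forall w, at_pt (nabla exponential_conn (cst a)
      (nabla exponential_conn (cst b) (cst z)) p) w =
    2 * (at_pt a w * at_pt b w * at_pt z w / at_pt p w ^+ 2 -
         at_pt p w * \sum_t (at_pt a t * at_pt b t * at_pt z t / at_pt p t ^+ 2)).
  move=> u0 v0 _; apply: at_ptP => w; rewrite !dE //.
  congr (2 * (_ - _ * _)); first by congr (_ / _); ring.
  by apply: eq_bigr => t _; congr (_ / _); ring.
move=> a0 b0 w; rewrite nabla_cst /nabla.
have -> : 'D_(cst a p) (fun q => exponential_conn q b z) p =
          rrow (fun i => rderiv a (exponential_ratfun b z i)) p.
  have [_ <-] := rrow_derive (exponential_ratfun b z) a pp.
  apply: near_eq_derive; have := near_positive pp.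
  by apply: filterS => q /exponential_ratfunE ->.
rewrite -[X in X + _]scale1r at_ptE mul1r at_pt_row (exponential_connE _ _ _ pp) /=.
have pw : at_pt p w != 0 by rewrite gt_eqF ?pp.
have S0 : reval (rderiv a (fisher_ratfun b z)) p =
    - \sum_t (at_pt a t * at_pt b t * at_pt z t / at_pt p t ^+ 2).
  rewrite rderiv_sumE -sumrN; apply: eq_bigr => t _ /=.
  by field; rewrite gt_eqF ?pp.
have -> : fisher p a (exponential_conn p b z) =
    - \sum_t (at_pt a t * at_pt b t * at_pt z t / at_pt p t ^+ 2).
  rewrite (fisherE _ _ pp).
  rewrite (eq_bigr (fun t => at_pt a t * fisher p b z -
      at_pt a t * at_pt b t * at_pt z t / at_pt p t ^+ 2)).
    by rewrite sumrB -mulr_suml a0 mul0r sub0r.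
  move=> t _; rewrite exponential_connE //.
  by field; rewrite gt_eqF ?pp.
rewrite exponential_connE // enum_rankK S0 -fisher_ratfunE //.
by field.
Qed.

Lemma mixture_flat p u v z :
  nabla mixture_conn (cst u) (nabla mixture_conn (cst v) (cst z)) p =
  nabla mixture_conn (cst v) (nabla mixture_conn (cst u) (cst z)) p.
Proof.
have D0 a b x : nabla mixture_conn (cst x) (nabla mixture_conn (cst a) (cst b)) p = 0.
  by rewrite nabla_cst; apply: etrans (addr0 _) _; exact: derive_cst.
by rewrite !D0.
Qed.

Lemma fisher_dual p u v z : open_simplex p ->
    sum_zero u -> sum_zero v -> sum_zero z ->
  'D_u (fun q => fisher q v z) p =
  fisher p (nabla exponential_conn (cst u) (cst v) p) z +
  fisher p v (nabla mixture_conn (cst u) (cst z) p).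
Proof.
move=> pS u0 v0 z0; have pp := simplex_positive pS; rewrite !nabla_cst.
have -> : 'D_u (fun q => fisher q v z) p = reval (rderiv u (fisher_ratfun v z)) p.
  have [_ <-] := reval_derive (fisher_ratfun v z) u pp.
  apply: near_eq_derive; have := near_positive pp.
  by apply: filterS => q /fisher_ratfunE ->.
rewrite rderiv_sumE !fisherE // -big_split /=.
rewrite [RHS](eq_bigr (fun t => fisher p u v * at_pt z t -
    at_pt u t * at_pt v t * at_pt z t / at_pt p t ^+ 2)).
  rewrite sumrB -mulr_sumr z0 mulr0 sub0r -sumrN; apply: eq_bigr => t _.
  by field; rewrite gt_eqF ?pp.
move=> t _; rewrite exponential_connE //.
rewrite (_ : at_pt (mixture_conn p u z) t = 0); last by rewrite /at_pt mxE.
by field; rewrite gt_eqF ?pp.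
Qed.

Lemma sum_zero_basis : exists b : 'I_#|Omega|.-1 -> E,
  sum_zero = [set v | exists c : 'I_#|Omega|.-1 -> R, v = \sum_i c i *: b i] /\
  (forall c : 'I_#|Omega|.-1 -> R, \sum_i c i *: b i = 0 -> forall i, c i = 0).
Proof.
have -> : sum_zero = [set v : E | \sum_i v 0 i = 0].
  apply/funext => v; rewrite /sum_zero /=; congr (_ = 0).
  by rewrite (reindex_onto enum_rank enum_val) /=;
    [apply: eq_bigl => w; rewrite enum_rankK eqxx | move=> i _; rewrite enum_valK].
case: #|Omega| => [|m].
  exists (fun=> 0); split; last by move=> c _ [].
  apply/seteqP; split=> v _ /=; last by rewrite big_ord0.
  by exists (fun=> 0); apply/rowP => -[].
rewrite -[m.+1.-1]/m; pose b i : 'rV[R]_m.+1 := delta_mx 0 (lift ord0 i) - delta_mx 0 ord0.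
have bE (c : 'I_m -> R) k : (\sum_i c i *: b i) 0 (lift ord0 k) = c k.
  rewrite summxE (bigD1 k) //= big1 ?addr0; last first.
    move=> i ik; rewrite !mxE /= (inj_eq lift_inj) eq_sym (negbTE ik).
    by rewrite subrr mulr0.
  by rewrite !mxE /= eqxx subr0 mulr1.
have b0 (c : 'I_m -> R) : (\sum_i c i *: b i) 0 ord0 = - \sum_i c i.
  rewrite summxE -sumrN; apply: eq_bigr => i _.
  by rewrite !mxE /= sub0r mulrN1.
exists b; split; last by move=> c /rowP c0 i; rewrite -bE c0 mxE.
apply/seteqP; split=> v /=.
  rewrite big_ord_recl => /eqP; rewrite addr_eq0 => /eqP v0.
  exists (fun i => v 0 (lift ord0 i)); apply/rowP => j.
  by case: (unliftP ord0 j) => [k ->|->]; [rewrite bE | rewrite b0].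
move=> [c ->]; rewrite big_ord_recl b0.
by rewrite [X in _ + X](eq_bigr c) ?addNr // => i _; exact: bE.
Qed.

Definition is_conn (B : E -> E -> E -> E) : Prop :=
  B = exponential_conn \/ B = mixture_conn.

Lemma fisher_smooth_dirs u v : sum_zero u -> sum_zero v ->
  smooth_on sum_zero open_simplex (fun p => fisher p u v).
Proof. by move=> _ _; exact: fisher_smooth. Qed.

Lemma fisher_sym_dirs p u v : open_simplex p -> sum_zero u -> sum_zero v ->
  fisher p u v = fisher p v u.
Proof. by move=> /simplex_positive pp _ _; exact: fisher_sym. Qed.

Lemma fisher_linear_dirs p a u v z : open_simplex p ->
    sum_zero u -> sum_zero v -> sum_zero z ->
  fisher p (a *: u + v) z = a * fisher p u z + fisher p v z.
Proof. by move=> /simplex_positive pp _ _ _; exact: fisher_linear. Qed.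

Lemma fisher_pos_dirs p u : open_simplex p -> sum_zero u -> u != 0 ->
  0 < fisher p u u.
Proof. by move=> /simplex_positive pp _; exact: fisher_pos. Qed.

Lemma is_conn_dirs B : is_conn B -> forall p u v, open_simplex p ->
  sum_zero u -> sum_zero v -> sum_zero (B p u v).
Proof.
case=> -> p u v pS _ _; first exact: exponential_dirs.
by rewrite /sum_zero /= big1 // => w _; rewrite /at_pt mxE.
Qed.

Lemma is_conn_smooth B : is_conn B -> forall u v, sum_zero u -> sum_zero v ->
  smooth_on sum_zero open_simplex (fun p => B p u v).
Proof.
by case=> -> u v _ _; [exact: exponential_conn_smooth | exact: mixture_conn_smooth].
Qed.

Lemma is_conn_linear B : is_conn B -> forall p a u v z, open_simplex p ->
    sum_zero u -> sum_zero v -> sum_zero z ->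
  B p (a *: u + v) z = a *: B p u z + B p v z /\
  B p z (a *: u + v) = a *: B p z u + B p z v.
Proof.
case=> -> p a u v z /simplex_positive pp _ _ _.
  by split; rewrite ?(exponential_sym z _ pp) (exponential_linear _ _ _ _ pp).
by rewrite /mixture_conn scaler0 addr0.
Qed.

Lemma is_conn_torsion_free B : is_conn B -> forall p u v, open_simplex p ->
    sum_zero u -> sum_zero v ->
  nabla B (cst u) (cst v) p = nabla B (cst v) (cst u) p.
Proof.
by case=> -> p u v /simplex_positive pp _ _; rewrite !nabla_cst //; exact: exponential_sym.
Qed.

Lemma is_conn_flat B : is_conn B -> forall p u v z, open_simplex p ->
    sum_zero u -> sum_zero v -> sum_zero z ->
  nabla B (cst u) (nabla B (cst v) (cst z)) p =
  nabla B (cst v) (nabla B (cst u) (cst z)) p.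
Proof.
by case=> -> *; [exact: exponential_flat | exact: mixture_flat].
Qed.

Definition probability_manifold : dually_flat_manifold E :=
  @DuallyFlatManifold R E #|Omega|.-1 open_simplex sum_zero
    fisher exponential_conn mixture_conn
    sum_zero_basis simplex_dirs simplex_open
    fisher_smooth_dirs fisher_sym_dirs fisher_linear_dirs fisher_pos_dirs
    is_conn_dirs is_conn_smooth is_conn_linear is_conn_torsion_free is_conn_flat
    fisher_dual.

End ProbabilityManifold.

(* Main.v *)
(**
Both families of affine coordinates are global.  Fixing a base point w0, the
probabilities of the other points are mixture-affine, with potential the
negative entropy sum p ln p, and the log-ratios ln (p_w / p_w0) are
exponential-affine, with inverse the softmax map and potential the logarithm
of the partition function.  In both charts the Hessian of the potential is the
Gram matrix of the coordinate fields for the Fisher metric, so its determinant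
is nonnegative.  Convexity is the tangent inequality, which reduces to
ln t <= t - 1 and to 1 + t <= e^t.  Smoothness holds because all the functions
involved lie in algebras generated by finitely many continuous functions whose
directional derivatives stay in the algebra.
*)
Require Import Defs.
From mathcomp Require Import all_boot all_order all_algebra.
From mathcomp Require Import all_classical all_reals all_analysis.
From mathcomp Require Import ring.
Set Implicit Arguments.
Unset Strict Implicit.
Unset Printing Implicit Defensive.
Import Order.TTheory GRing.Theory Num.Theory.
Import numFieldNormedType.Exports.
Local Open Scope classical_set_scope.
Local Open Scope ring_scope.

Section DirectionalDerivatives.
Context {R : realType} {F : normedModType R}.
Implicit Types (p u v : F).

Lemma is_derive_line_comp (f : R -> R) (a : F -> R) p v (d l : R) :
  is_derive (a p) 1 f d -> is_derive p v a l ->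
  is_derive p v (f \o a) (d * l).
Proof.
have lineD (W : normedModType R) (h : F -> W) :
    'D_v h p = 'D_1 (fun t : R => h (t *: v + p)) 0.
  rewrite /derive; set g1 := fun t => t^-1 *: _; set g2 := fun t => t^-1 *: _.
  suff -> : g1 = g2 by [].
  by rewrite funeqE /g1 /g2 => t /=; rewrite addr0 scale0r add0r [t%:A]mulr1.
move=> fd [/derivable1P da]; rewrite lineD => al.
have ad : is_derive (0 : R) 1 (fun t : R => a (t *: v + p)) l by apply: DeriveDef.
have fd0 : is_derive ((fun t : R => a (t *: v + p)) 0) 1 f d.
  by rewrite /= scale0r add0r.
have [dc cl] := is_derive1_comp fd0 ad.
by apply: DeriveDef; [exact/derivable1P|rewrite lineD].
Qed.

Lemma is_derive_bigsum (I : Type) (s : seq I) (h : I -> F -> R) (dh : I -> R) p v :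
  (forall i, is_derive p v (h i) (dh i)) ->
  is_derive p v (fun q => \sum_(i <- s) h i q) (\sum_(i <- s) dh i).
Proof.
move=> hd; elim: s => [|i s IH].
  by under eq_fun do rewrite big_nil; rewrite big_nil; exact: is_derive_cst.
under eq_fun do rewrite big_cons.
rewrite big_cons; exact: is_deriveD.
Qed.

Lemma continuous_bigsum (I : Type) (s : seq I) (h : I -> F -> R) p :
  (forall i, {for p, continuous (h i)}) ->
  {for p, continuous (fun q => \sum_(i <- s) h i q)}.
Proof.
move=> hc; elim: s => [|i s IH].
  rewrite (_ : (fun q => _) = cst 0); first exact: cst_continuous.
  by apply/funext => q; rewrite big_nil.
rewrite (_ : (fun q => _) = h i + (fun q => \sum_(j <- s) h j q)).
  by apply: continuousD => //; exact: hc.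
by apply/funext => q; rewrite big_cons.
Qed.

Lemma is_derive_row n (f : F -> 'rV[R]_n) p v (d : 'rV[R]_n) :
  (forall i, is_derive p v (fun q => f q 0 i) (d 0 i)) -> is_derive p v f d.
Proof.
move=> fi; have df : derivable f p v.
  by apply/derivable_mxP => i j; rewrite ord1; case: (fi j).
apply: DeriveDef => //; rewrite derive_mx //; apply/rowP => j.
by rewrite mxE; case: (fi j).
Qed.

Lemma row_continuous n (f : F -> 'rV[R]_n) p :
  (forall i, {for p, continuous (fun q => f q 0 i)}) -> {for p, continuous f}.
Proof.
move=> fi; apply/cvgrPdist_le => /= e e0; near=> q.
rewrite /Num.Def.normr /= mx_normrE (bigmax_le _ (ltW e0)) //= => -[i j] _.
rewrite !mxE /= ord1; move: j; near: q; apply: filter_forall => j.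
by have /cvgrPdist_le := fi j; exact.
Unshelve. all: by end_near. Qed.

Lemma second_derive (W : normedModType R) (O : set F) (f g : F -> W) p u v (d : W) :
  open O -> O p -> (forall q, O q -> is_derive q u f (g q)) ->
  is_derive p v g d -> 'D_v ('D_u f) p = d.
Proof.
move=> oO Op fg [_ <-]; apply: near_eq_derive.
have := open_nbhs_nbhs (conj oO Op).
by apply: filterS => q /fg [].
Qed.

Lemma smooth_on_stable (W : normedModType R) (O T U : set F) (S : set (F -> W)) f :
  (forall g, S g -> forall p, O p -> {for p, continuous g}) ->
  (forall g, S g -> forall p v, O p -> derivable g p v) ->
  (forall g, S g -> forall v, S ('D_v g)) ->
  U `<=` O -> S f -> smooth_on T U f.
Proof.
move=> Sc Sd SD UO Sf vs _.
have Svs : S (iter_derive vs f) by elim: vs => //= v vs IH; exact: SD.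
split=> [|p v /UO Op _]; last exact: Sd.
by apply: continuous_in_subspaceT => p /set_mem /UO; exact: Sc.
Qed.

End DirectionalDerivatives.

Section GeneratedAlgebra.
Context {R : realType} {F : normedModType R}.
Variables (O : set F) (G : set (F -> R)).
Hypothesis openO : open O.

Inductive gen_alg : (F -> R) -> Prop :=
  | gen_cst c : gen_alg (fun=> c)
  | gen_in f : G f -> gen_alg f
  | gen_add f g : gen_alg f -> gen_alg g -> gen_alg (fun p => f p + g p)
  | gen_mul f g : gen_alg f -> gen_alg g -> gen_alg (fun p => f p * g p)
  | gen_eq f g : gen_alg f -> (forall p, O p -> f p = g p) -> gen_alg g.

Lemma gen_sum (I : Type) (s : seq I) (f : I -> F -> R) :
  (forall i, gen_alg (f i)) -> gen_alg (fun p => \sum_(i <- s) f i p).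
Proof.
move=> fg; elim: s => [|i s IH].
  by under eq_fun do rewrite big_nil; exact: gen_cst.
by under eq_fun do rewrite big_cons; exact: gen_add.
Qed.

Hypothesis contG : forall f, G f -> forall p, O p -> {for p, continuous f}.
Hypothesis deriveG : forall f, G f -> forall v,
  exists2 g, gen_alg g & forall p, O p -> is_derive p v f (g p).

Lemma near_domain p (P : set F) : (forall q, O q -> P q) -> O p -> \near p, P p.
Proof. by move=> OP Op; apply: filterS OP _; exact: open_nbhs_nbhs. Qed.

Lemma gen_continuous f : gen_alg f -> forall p, O p -> {for p, continuous f}.
Proof.
elim=> {f} [c|f Gf|f g _ fc _ gc|f g _ fc _ gc|f g _ fc fg] p Op.
- exact: cst_continuous.
- exact: contG.
- by apply: continuousD; [exact: fc|exact: gc].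
- by apply: continuousM; [exact: fc|exact: gc].
- have nfg : \near p, f p = g p by apply: near_domain Op.
  rewrite /prop_for /continuous_at -(fg p Op); apply: cvg_trans (fc p Op).
  exact: near_eq_cvg nfg.
Qed.

Lemma gen_derive f v : gen_alg f ->
  exists2 g, gen_alg g & forall p, O p -> is_derive p v f (g p).
Proof.
elim=> {f} [c|f Gf|f g fG [f' f'G fd] gG [g' g'G gd]
           |f g fG [f' f'G fd] gG [g' g'G gd]|f g fG [f' f'G fd] fg].
- by exists (fun=> 0); [exact: gen_cst|move=> p _; exact: is_derive_cst].
- exact: deriveG.
- exists (fun p => f' p + g' p); first exact: gen_add.
  by move=> p Op; have := is_deriveD (fd p Op) (gd p Op).
- exists (fun p => f p * g' p + g p * f' p).
    by apply: gen_add; exact: gen_mul.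
  by move=> p Op; have := is_deriveM (fd p Op) (gd p Op).
- exists f' => // p Op; apply: near_eq_is_derive (fd p Op).
  exact: near_domain Op.
Qed.

Lemma gen_derivable f v p : gen_alg f -> O p -> derivable f p v.
Proof. by move=> /(gen_derive v) [g _ fd] /fd []. Qed.

Lemma gen_D f v : gen_alg f -> gen_alg ('D_v f).
Proof.
move=> /(gen_derive v) [g gG fd]; apply: gen_eq gG _ => p /fd.
by case=> _ ->.
Qed.

Lemma gen_smooth (T U : set F) f : U `<=` O -> gen_alg f -> smooth_on T U f.
Proof.
move=> UO fG; apply: (@smooth_on_stable _ _ _ O _ _ gen_alg) UO fG.
- by move=> g gG p; exact: gen_continuous.
- by move=> g gG p v; exact: gen_derivable.
- by move=> g gG v; exact: gen_D.
Qed.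

Lemma gen_smooth_row n (T U : set F) (f : F -> 'rV[R]_n) : U `<=` O ->
  (forall i, gen_alg (fun p => f p 0 i)) -> smooth_on T U f.
Proof.
move=> UO fG; pose S := [set g : F -> 'rV[R]_n | forall i, gen_alg (fun p => g p 0 i)].
have Sd g p v : S g -> O p -> derivable g p v.
  by move=> gS Op; apply/derivable_mxP => i j; rewrite ord1; exact: gen_derivable.
apply: (@smooth_on_stable _ _ _ O _ _ S) UO fG.
- by move=> g gS p Op; apply: row_continuous => i; exact: gen_continuous.
- by move=> g gS p v; exact: Sd.
- move=> g gS v i; apply: gen_eq (gen_D v (gS i)) _ => p Op.
  by rewrite derive_mx ?mxE //; exact: Sd.
Qed.

End GeneratedAlgebra.

Section ConvexityDeterminant.
Context {R : realType}.

Lemma tangent_convex n (V : set 'rV[R]_n) (Phi : 'rV[R]_n -> R)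
    (d : 'rV[R]_n -> 'rV[R]_n -> R) :
  convex_set V ->
  (forall z a u v, d z (a *: u + v) = a * d z u + d z v) ->
  (forall z x, V z -> V x -> Phi z + d z (x - z) <= Phi x) ->
  convex_function V Phi.
Proof.
move=> cV dl tg t x y xV yV.
have := cV x y t xV yV; rewrite inE => Vz.
move: xV yV; rewrite !inE => Vx Vy.
have d0 z : d z 0 = 0.
  by have := dl z 1 0 0; rewrite scaler0 addr0 mul1r => /eqP; rewrite -subr_eq subrr => /eqP.
have dZ z a u : d z (a *: u) = a * d z u.
  by have := dl z a u 0; rewrite addr0 d0 addr0.
move: Vz; set z : 'rV[R]_n := conv t x y => Vz.
have zE : z = t%:num *: x + (1 - t%:num) *: y by [].
have xz : x - z = (1 - t%:num) *: (x - y).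
  by rewrite zE; apply/rowP => i; rewrite !mxE; ring.
have yz : y - z = (- t%:num) *: (x - y).
  by rewrite zE; apply/rowP => i; rewrite !mxE; ring.
have := tg z x Vz Vx; have := tg z y Vz Vy; rewrite xz yz !dZ.
set D := d z _ => hy hx.
have t0 : 0 <= t%:num by exact: ge0.
have t1 : 0 <= 1 - t%:num by rewrite subr_ge0; exact: le1.
have := lerD (ler_wpM2l t0 hx) (ler_wpM2l t1 hy).
rewrite convRE; apply: le_trans; rewrite le_eqVlt; apply/orP; left; apply/eqP.
by ring.
Qed.

(* det ((1 - t) I + t A) is 1 at t = 0 and has no root in [0, 1[ *)
Lemma det_psd_ge0 n (A : 'M[R]_n) :
  (forall v : 'rV[R]_n, 0 <= (v *m A *m v^T) 0 0) -> 0 <= \det A.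
Proof.
move=> psd; rewrite leNgt; apply/negP => dA.
pose B : 'M[{poly R}]_n := \matrix_(i, j) ((1%:M i j)%:P * (1 - 'X) + (A i j)%:P * 'X).
have BE t : (\det B).[t] = \det ((1 - t) *: 1%:M + t *: A).
  rewrite -horner_evalE -det_map_mx; congr (\det _); apply/matrixP => i j.
  by rewrite !mxE -[LHS]/(_.[t]) !hornerE mulrC [t * _]mulrC.
have B0 : (\det B).[0] = 1 by rewrite BE subr0 scale1r scale0r addr0 det1.
have B1 : (\det B).[1] = \det A by rewrite BE subrr scale1r scale0r add0r.
have [||t /andP[t0 t1] /rootP] := @poly_ivt _ (- \det B) 0 1.
- exact: ler01.
- by rewrite !hornerE B0 B1 oppr_le0 ler01 oppr_ge0 ltW.
rewrite hornerN => /eqP; rewrite oppr_eq0 BE => /det0P[v v0 vB].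
have t1' : 0 < 1 - t.
  rewrite subr_gt0 lt_neqAle t1 andbT; apply/eqP => t1e.
  move: vB; rewrite t1e subrr scale0r add0r scale1r => vA.
  by move: dA; rewrite lt_neqAle => /andP[/det0P[]]; exists v.
have : (v *m ((1 - t) *: 1%:M + t *: A) *m v^T) 0 0 = 0 by rewrite vB mul0mx mxE.
rewrite mulmxDr mulmxDl -!scalemxAr -!scalemxAl mulmx1 mxE [X in X + _]mxE [X in _ + X]mxE.
have vv : 0 < (v *m v^T) 0 0.
  rewrite mxE lt_neqAle sumr_ge0 ?andbT; last first.
    by move=> i _; rewrite mxE -expr2 sqr_ge0.
  apply: contra v0; rewrite eq_sym psumr_eq0; last first.
    by move=> i _; rewrite mxE -expr2 sqr_ge0.
  move=> /allP s0; apply/eqP/rowP => i.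
  by have := s0 i (mem_index_enum i); rewrite !mxE mulf_eq0 orbb => /eqP.
move/eqP; rewrite gt_eqF // ltr_wpDr ?mulr_gt0 //.
by rewrite mulr_ge0.
Qed.

End ConvexityDeterminant.

Section AffineLogarithms.
Context {R : realType} {F : normedModType R} (I : Type).
Variables (O : set F) (a : I -> F -> R) (l : F -> I -> R).
Hypothesis a_gt0 : forall i p, O p -> 0 < a i p.
Hypothesis a_continuous : forall i p, {for p, continuous (a i)}.
Hypothesis a_derive : forall i p v, is_derive p v (a i) (l v i).

Definition log_gens : set (F -> R) :=
  [set f | exists i, [\/ f = a i, f = @ln R \o a i | f = (fun p => (a i p)^-1)]].

Lemma derive_ln_affine i p v : O p ->
  is_derive p v (fun q => ln (a i q)) (l v i / a i p).
Proof.
move=> Op; have := is_derive1_ln (a_gt0 i Op).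
by move=> /is_derive_line_comp /(_ (a_derive i p v)); rewrite mulrC.
Qed.

Lemma log_gens_continuous f : log_gens f -> forall p, O p -> {for p, continuous f}.
Proof.
move=> [i []-> p Op]; first exact: a_continuous.
  by apply: continuous_comp; [exact: a_continuous|exact/continuous_ln/a_gt0].
by apply: cvgV; [rewrite gt_eqF // a_gt0|exact: a_continuous].
Qed.

Lemma log_gens_derive f : log_gens f -> forall v,
  exists2 g, gen_alg O log_gens g & forall p, O p -> is_derive p v f (g p).
Proof.
move=> [i fi] v.
have gI : gen_alg O log_gens (fun p => (a i p)^-1).
  by apply: gen_in; exists i; apply: Or33.
case: fi => ->.
- by exists (fun=> l v i); [exact: gen_cst|].
- exists (fun p => l v i * (a i p)^-1).
    by apply: gen_mul => //; exact: gen_cst.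
  by move=> p; exact: derive_ln_affine.
- exists (fun p => - l v i * ((a i p)^-1 * (a i p)^-1)).
    by apply: gen_mul; [exact: gen_cst|exact: gen_mul].
  move=> p Op; have a0 : a i p != 0 by rewrite gt_eqF ?a_gt0.
  have [da de] := a_derive i p v.
  apply: DeriveDef; first exact: derivableV.
  by rewrite deriveV // de /GRing.scale /=; field.
Qed.

End AffineLogarithms.

Section BasePoint.
Context {R : realType} {Omega : finType} (w0 : Omega).
Local Notation n := #|Omega|.-1.
Local Notation E := 'rV[R]_#|Omega|.

Definition off_base (i : 'I_n) : Omega := enum_val (cast_ord (esym (cardC1 w0)) i).

Lemma off_base_neq i : (off_base i == w0) = false.
Proof. by apply/negbTE; have := enum_valP (cast_ord (esym (cardC1 w0)) i). Qed.

Lemma off_base_eq i j : (off_base i == off_base j) = (i == j).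
Proof. by rewrite (inj_eq enum_val_inj) (inj_eq (@cast_ord_inj _ _ _)). Qed.

Lemma off_baseP w : w != w0 -> exists i, w = off_base i.
Proof.
move=> ww0; have wA : w \in predC1 w0 by [].
exists (cast_ord (cardC1 w0) (enum_rank_in wA w)).
by rewrite /off_base cast_ordK enum_rankK_in.
Qed.

Lemma sum_off_base (f : Omega -> R) : \sum_w f w = f w0 + \sum_i f (off_base i).
Proof.
rewrite (bigD1 w0) //=; congr (_ + _).
rewrite (eq_bigl (mem (predC1 w0))) // big_enum_val.
rewrite (reindex (cast_ord (esym (cardC1 w0)))) //=.
by exists (cast_ord (cardC1 w0)) => i _; rewrite ?cast_ordK ?cast_ordKV.
Qed.

Definition of_pt (f : Omega -> R) : E := \row_j f (enum_val j).

Lemma at_of_pt f w : at_pt (of_pt f) w = f w.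
Proof. by rewrite /at_pt mxE enum_rankK. Qed.

Lemma is_derive_at_pt (V : normedModType R) (f : V -> E) p v (d : E) :
  (forall w, is_derive p v (fun q => at_pt (f q) w) (at_pt d w)) ->
  is_derive p v f d.
Proof.
move=> fw; apply: is_derive_row => i.
by have := fw (enum_val i); rewrite /at_pt enum_valK.
Qed.

Lemma positive_simplex (q p : E) : open_simplex q -> positive p ->
  \sum_w at_pt p w = 1 -> open_simplex p.
Proof.
move=> [q01 q1] pp p1; split=> // w; rewrite pp /=.
move: q1 p1; rewrite (bigD1 w) //= => q1; rewrite (bigD1 w) //= => p1.
have [w' w'w] : exists w', w' != w.
  apply: contrapT => /forallNP all_w; have /andP[_] := q01 w.
  rewrite -q1 big1 ?addr0 ?ltxx // => t tw; by have := all_w t; rewrite tw.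
rewrite -p1 ltrDl (bigD1 w') //= ltr_wpDr //.
by apply: sumr_ge0 => t _; exact/ltW.
Qed.

Definition linform (k : 'I_n -> Omega -> R) (y : 'rV[R]_n) w : R :=
  \sum_i y 0 i * k i w.

Lemma linformP k a u v w :
  linform k (a *: u + v) w = a * linform k u w + linform k v w.
Proof.
rewrite /linform mulr_sumr -big_split /=; apply: eq_bigr => i _.
by rewrite !mxE; ring.
Qed.

Lemma linformZ k a u w : linform k (a *: u) w = a * linform k u w.
Proof.
rewrite /linform mulr_sumr; apply: eq_bigr => i _.
by rewrite mxE mulrA.
Qed.

Lemma linform_continuous k w y : {for y, continuous (linform k ^~ w)}.
Proof.
apply: continuous_bigsum => i; apply: continuousM; first exact: coord_continuous.
exact: cst_continuous.
Qed.

Lemma linform_derive k w (y v : 'rV[R]_n) :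
  is_derive y v (linform k ^~ w) (linform k v w).
Proof.
apply: is_derive_bigsum => i.
have dy : is_derive y v (fun q : 'rV[R]_n => q 0 i) (v 0 i).
  have dv := @derivable_id _ _ y v; have /derivable_mxP dc := dv.
  apply: DeriveDef; first exact: dc.
  by have /matrixP /(_ 0 i) := derive_mx dv; rewrite derive_id mxE => <-.
have := is_deriveM dy (is_derive_cst (k i w) y v).
by move/is_derive_eq; apply; rewrite scaler0 add0r [LHS]mulrC.
Qed.

Lemma gram_fisher_ge0 (p : E) m (b : 'I_m -> E) : positive p ->
  0 <= \det (\matrix_(i, j) fisher p (b i) (b j)).
Proof.
move=> pp; apply: det_psd_ge0 => v.
rewrite [leRHS](_ : _ = \sum_w (\sum_i v 0 i * at_pt (b i) w) ^+ 2 / at_pt p w).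
  by apply: sumr_ge0 => w _; rewrite divr_ge0 ?sqr_ge0 // ltW.
rewrite mxE.
under [RHS]eq_bigr => w _ do rewrite expr2 big_distrl /= mulr_suml.
rewrite exchange_big /= [LHS](eq_bigr (fun j => \sum_i v 0 i * v 0 j * fisher p (b i) (b j))).
  rewrite exchange_big; apply: eq_bigr => i _ /=.
  under eq_bigr => j _ do rewrite fisherE // mulr_sumr.
  rewrite exchange_big; apply: eq_bigr => w _ /=.
  by rewrite mulr_sumr mulr_suml; apply: eq_bigr => j _; ring.
move=> j _; rewrite !mxE mulr_suml; apply: eq_bigr => i _; rewrite mxE.
by ring.
Qed.

End BasePoint.

Section MixtureChart.
Context {R : realType} {Omega : finType} (w0 : Omega).
Local Notation n := #|Omega|.-1.
Local Notation E := 'rV[R]_#|Omega|.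

Definition mix_dir (i : 'I_n) (w : Omega) : R :=
  (w == off_base w0 i)%:R - (w == w0)%:R.

Definition mix_point (y : 'rV[R]_n) : E :=
  of_pt (fun w => (w == w0)%:R + linform mix_dir y w).

Definition mix_coord (p : E) : 'rV[R]_n := \row_i at_pt p (off_base w0 i).

Definition mix_domain : set 'rV[R]_n := [set y | positive (mix_point y)].

Definition neg_entropy (y : 'rV[R]_n) : R :=
  \sum_w at_pt (mix_point y) w * ln (at_pt (mix_point y) w).

Lemma at_mix y w :
  at_pt (mix_point y) w = (w == w0)%:R + linform mix_dir y w.
Proof. exact: at_of_pt. Qed.

Lemma at_mixE w :
  (fun y => at_pt (mix_point y) w) = cst (w == w0)%:R + linform mix_dir ^~ w.
Proof. by apply/funext => y; rewrite at_mix. Qed.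

Lemma at_mix_off y i : at_pt (mix_point y) (off_base w0 i) = y 0 i.
Proof.
rewrite at_mix off_base_neq add0r /linform (bigD1 i) //= big1 ?addr0.
  by rewrite /mix_dir eqxx off_base_neq subr0 mulr1.
by move=> j ji; rewrite /mix_dir off_base_eq off_base_neq eq_sym (negbTE ji) subrr mulr0.
Qed.

Lemma at_mix_base y : at_pt (mix_point y) w0 = 1 - \sum_i y 0 i.
Proof.
rewrite at_mix eqxx /linform -sumrN; congr (_ + _); apply: eq_bigr => i _.
by rewrite /mix_dir eqxx eq_sym off_base_neq sub0r mulrN1.
Qed.

Lemma mix_sum y : \sum_w at_pt (mix_point y) w = 1.
Proof.
rewrite (sum_off_base w0) at_mix_base; under [X in _ + X]eq_bigr do rewrite at_mix_off.
by rewrite subrK.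
Qed.

Lemma mix_pointK y : mix_coord (mix_point y) = y.
Proof. by apply/rowP => i; rewrite mxE at_mix_off. Qed.

Lemma mix_coordK (p : E) : \sum_w at_pt p w = 1 -> mix_point (mix_coord p) = p.
Proof.
move=> p1; apply: at_ptP => w; have [->|/off_baseP[i ->]] := eqVneq w w0.
  rewrite at_mix_base -p1 (sum_off_base w0).
  by under [X in _ - X]eq_bigr do rewrite mxE; rewrite addrK.
by rewrite at_mix_off mxE.
Qed.

Lemma at_mix_continuous w y : {for y, continuous (fun q => at_pt (mix_point q) w)}.
Proof.
rewrite at_mixE; apply: continuousD; first exact: cst_continuous.
exact: linform_continuous.
Qed.

Lemma at_mix_derive w y v :
  is_derive y v (fun q => at_pt (mix_point q) w) (linform mix_dir v w).
Proof.
rewrite at_mixE.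
have := is_deriveD (is_derive_cst ((w == w0)%:R : R) y v) (linform_derive mix_dir w y v).
by rewrite add0r.
Qed.

Lemma ln_mix_derive w y v : mix_domain y ->
  is_derive y v (fun q => ln (at_pt (mix_point q) w))
    (linform mix_dir v w / at_pt (mix_point y) w).
Proof.
move=> py; apply: (@derive_ln_affine _ _ _ mix_domain
  (fun w y => at_pt (mix_point y) w) (linform mix_dir)) => //.
by move=> i p t; exact: at_mix_derive.
Qed.

Lemma mix_point_derive y v :
  is_derive y v mix_point (of_pt (linform mix_dir v)).
Proof.
by apply: is_derive_at_pt => w; rewrite at_of_pt; exact: at_mix_derive.
Qed.

Lemma open_mix_domain : open mix_domain.
Proof.
rewrite openE => y py.
apply: (@filter_forall _ Omega (fun w q => 0 < at_pt (mix_point q) w) (nbhs y) _).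
move=> w; have cw : at_pt (mix_point q) w @[q --> y] --> at_pt (mix_point y) w.
  exact: at_mix_continuous.
exact: cvgr_gt cw _ (py w).
Qed.

Lemma convex_mix_domain : convex_set mix_domain.
Proof.
move=> x y t; rewrite !inE => px py w.
have zE : conv t x y = t%:num *: x + (1 - t%:num) *: y by [].
have -> : at_pt (mix_point (conv t x y)) w = conv t
    (at_pt (mix_point x) w : R^o) (at_pt (mix_point y) w : R^o).
  by rewrite zE convRE !at_mix linformP linformZ /unstable.onem; ring.
by apply: convR_gt0; [exact: px|exact: py].
Qed.

Local Notation mix_gens := (log_gens (fun w y => at_pt (mix_point y) w)).

Lemma mix_gens_continuous f : mix_gens f ->
  forall y, mix_domain y -> {for y, continuous f}.
Proof.
apply: log_gens_continuous => [w y py|w y]; first exact: py.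
exact: at_mix_continuous.
Qed.

Lemma mix_gens_derive f : mix_gens f -> forall v,
  exists2 g, gen_alg mix_domain mix_gens g &
    forall y, mix_domain y -> is_derive y v f (g y).
Proof.
apply: (@log_gens_derive _ _ _ mix_domain _ (linform mix_dir)) => [w y py|w y v].
  exact: py.
exact: at_mix_derive.
Qed.

Lemma mix_point_smooth T : smooth_on T mix_domain mix_point.
Proof.
apply: (gen_smooth_row open_mix_domain mix_gens_continuous mix_gens_derive) => // i.
apply: gen_in; exists (enum_val i); apply: Or31; apply/funext => y.
by rewrite /at_pt enum_valK.
Qed.

Lemma neg_entropy_smooth T : smooth_on T mix_domain neg_entropy.
Proof.
apply: (gen_smooth open_mix_domain mix_gens_continuous mix_gens_derive) => //.
apply: gen_sum => w; apply: gen_mul; apply: gen_in.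
  by exists w; apply: Or31.
by exists w; apply: Or32.
Qed.

Lemma neg_entropy_convex : convex_function mix_domain neg_entropy.
Proof.
apply: (@tangent_convex _ _ _ _
  (fun z u => \sum_w (ln (at_pt (mix_point z) w) + 1) * linform mix_dir u w)).
- exact: convex_mix_domain.
- move=> z a u v; rewrite mulr_sumr -big_split; apply: eq_bigr => w _ /=.
  by rewrite linformP; ring.
- move=> z x pz px; rewrite /neg_entropy -big_split; apply: ler_sum => w _ /=.
  have := px w; have := pz w; rewrite !at_mix => pzw pxw.
  rewrite (_ : linform mix_dir (x - z) w = linform mix_dir x w - linform mix_dir z w); last first.
    by rewrite addrC -scaleN1r linformP; ring.
  move: pzw pxw; set P := _ + linform _ z w; set Q := _ + linform _ x w => P0 Q0.
  have -> : linform mix_dir x w - linform mix_dir z w = Q - P by rewrite /P /Q; ring.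
  have : ln (P / Q) <= P / Q - 1.
    have := @le_ln1Dx R (P / Q - 1); rewrite [1 + _]addrCA subrr addr0; apply.
    by rewrite ltrBrDl subrr divr_gt0.
  rewrite ln_div ?posrE // => h; have := ler_wpM2l (ltW Q0) h.
  have -> : Q * (P / Q - 1) = P - Q by field; rewrite gt_eqF.
  move=> {}h; rewrite -subr_ge0.
  have -> : Q * ln Q - (P * ln P + (ln P + 1) * (Q - P)) =
            (P - Q) - Q * (ln P - ln Q) by ring.
  by rewrite subr_ge0.
Qed.

Lemma neg_entropy_hess y u v : mix_domain y ->
  'D_u ('D_v neg_entropy) y =
  fisher (mix_point y) ('D_u mix_point y) ('D_v mix_point y).
Proof.
move=> py; have [_ ->] := mix_point_derive y u; have [_ ->] := mix_point_derive y v.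
rewrite fisherE //.
apply: (@second_derive _ _ _ mix_domain neg_entropy
  (fun q => \sum_w (ln (at_pt (mix_point q) w) + 1) * linform mix_dir v w)) => //.
- exact: open_mix_domain.
- move=> q pq; apply: is_derive_bigsum => w.
  have := is_deriveM (at_mix_derive w q v) (ln_mix_derive w v pq).
  move/is_derive_eq; apply; rewrite /GRing.scale /=.
  by field; rewrite gt_eqF // pq.
- apply: is_derive_bigsum => w.
  have := is_deriveM (is_deriveD (ln_mix_derive w u py) (is_derive_cst (1 : R) y u))
    (is_derive_cst (linform mix_dir v w) y u).
  move/is_derive_eq; apply; rewrite /GRing.scale /= !(at_of_pt (linform _ _)).
  by field; rewrite gt_eqF // py.
Qed.

End MixtureChart.

Section SoftmaxChart.
Context {R : realType} {Omega : finType} (w0 : Omega).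
Local Notation n := #|Omega|.-1.
Local Notation E := 'rV[R]_#|Omega|.
Implicit Types (y u v : 'rV[R]_n) (w : Omega).

Definition stat (i : 'I_n) w : R := (w == off_base w0 i)%:R.

Definition partition_fun y : R := \sum_w expR (linform stat y w).

Definition log_partition y : R := ln (partition_fun y).

Definition softmax y : E :=
  of_pt (fun w => expR (linform stat y w) / partition_fun y).

Definition softmax_mean y (f : Omega -> R) : R := \sum_w at_pt (softmax y) w * f w.

Definition log_ratio (p : E) : 'rV[R]_n :=
  \row_i (ln (at_pt p (off_base w0 i)) - ln (at_pt p w0)).

Lemma partition_gt0 y : 0 < partition_fun y.
Proof.
rewrite /partition_fun (bigD1 w0) //= ltr_wpDr ?expR_gt0 //.
by apply: sumr_ge0 => w _; exact: expR_ge0.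
Qed.

Lemma partition_neq0 y : partition_fun y != 0.
Proof. by rewrite gt_eqF ?partition_gt0. Qed.

Lemma at_softmax y w :
  at_pt (softmax y) w = expR (linform stat y w) / partition_fun y.
Proof. exact: at_of_pt. Qed.

Lemma softmax_positive y : positive (softmax y).
Proof. by move=> w; rewrite at_softmax divr_gt0 ?expR_gt0 ?partition_gt0. Qed.

Lemma softmax_neq0 y w : at_pt (softmax y) w != 0.
Proof. by rewrite gt_eqF ?softmax_positive. Qed.

Lemma softmax_sum y : \sum_w at_pt (softmax y) w = 1.
Proof.
under eq_bigr do rewrite at_softmax.
by rewrite -mulr_suml divff ?partition_neq0.
Qed.

Lemma stat_off y i : linform stat y (off_base w0 i) = y 0 i.
Proof.
rewrite /linform (bigD1 i) //= big1 ?addr0; first by rewrite /stat eqxx mulr1.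
by move=> j ji; rewrite /stat off_base_eq eq_sym (negbTE ji) mulr0.
Qed.

Lemma stat_base y : linform stat y w0 = 0.
Proof.
by rewrite /linform big1 // => i _; rewrite /stat eq_sym off_base_neq mulr0.
Qed.

Lemma softmaxK y : log_ratio (softmax y) = y.
Proof.
apply/rowP => i; rewrite mxE !at_softmax stat_off stat_base expR0.
by rewrite !ln_div ?posrE ?expR_gt0 ?partition_gt0 ?ltr01 // expRK ln1; ring.
Qed.

Lemma log_ratioK (p : E) : positive p -> \sum_w at_pt p w = 1 ->
  softmax (log_ratio p) = p.
Proof.
move=> pp p1.
have eE w : expR (linform stat (log_ratio p) w) = at_pt p w / at_pt p w0.
  have [->|/off_baseP[i ->]] := eqVneq w w0.
    by rewrite stat_base expR0 divff // gt_eqF.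
  by rewrite stat_off mxE expRB !lnK ?posrE.
apply: at_ptP => w; rewrite at_softmax /partition_fun eE.
under eq_bigr do rewrite eE.
by rewrite -mulr_suml p1; field; rewrite gt_eqF // pp.
Qed.

Lemma sum_exp_stat y (f : Omega -> R) :
  \sum_w expR (linform stat y w) * f w = partition_fun y * softmax_mean y f.
Proof.
rewrite /softmax_mean mulr_sumr; apply: eq_bigr => w _; rewrite at_softmax.
by field; exact: partition_neq0.
Qed.

Lemma exp_stat_derive w y v : is_derive y v (fun q => expR (linform stat q w))
  (expR (linform stat y w) * linform stat v w).
Proof. exact: is_derive_line_comp (is_derive_expR _) (linform_derive stat w y v). Qed.

Lemma partition_derive y v : is_derive y v partition_fun
  (partition_fun y * softmax_mean y (linform stat v)).
Proof.
rewrite -sum_exp_stat; apply: is_derive_bigsum => w; exact: exp_stat_derive.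
Qed.

Lemma log_partition_derive y v :
  is_derive y v log_partition (softmax_mean y (linform stat v)).
Proof.
have := is_derive_line_comp (is_derive1_ln (partition_gt0 y)) (partition_derive y v).
by move/is_derive_eq; apply; rewrite mulKf ?partition_neq0.
Qed.

Lemma at_softmax_derive w y v : is_derive y v (fun q => at_pt (softmax q) w)
  (at_pt (softmax y) w * (linform stat v w - softmax_mean y (linform stat v))).
Proof.
have [dZ Ze] := partition_derive y v.
have dV : is_derive y v (fun q => (partition_fun q)^-1)
    (- (partition_fun y)^-1 * softmax_mean y (linform stat v)).
  apply: DeriveDef; first exact: derivableV (partition_neq0 y) dZ.
  rewrite deriveV ?partition_neq0 // Ze /GRing.scale /=.
  by field; exact: partition_neq0.
under eq_fun do rewrite at_softmax.
have := is_deriveM (exp_stat_derive w y v) dV.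
move/is_derive_eq; apply; rewrite at_softmax /GRing.scale /=.
by field; exact: partition_neq0.
Qed.

Lemma softmax_derive y v : is_derive y v softmax
  (of_pt (fun w => at_pt (softmax y) w *
     (linform stat v w - softmax_mean y (linform stat v)))).
Proof.
by apply: is_derive_at_pt => w; rewrite at_of_pt; exact: at_softmax_derive.
Qed.

Lemma partition_continuous y : {for y, continuous partition_fun}.
Proof.
apply: continuous_bigsum => w; apply: continuous_comp; last exact: continuous_expR.
exact: linform_continuous.
Qed.

Lemma log_partition_continuous y : {for y, continuous log_partition}.
Proof.
apply: continuous_comp; first exact: partition_continuous.
exact/continuous_ln/partition_gt0.
Qed.

Lemma at_softmax_continuous w y : {for y, continuous (fun q => at_pt (softmax q) w)}.
Proof.
rewrite (_ : (fun q => _) =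
  (fun q => expR (linform stat q w)) * (fun q => (partition_fun q)^-1)).
  apply: continuousM.
    apply: continuous_comp; last exact: continuous_expR.
    exact: linform_continuous.
  by apply: continuousV; [exact: partition_neq0|exact: partition_continuous].
by apply/funext => q; rewrite at_softmax.
Qed.

Definition softmax_gens : set ('rV[R]_n -> R) :=
  [set f | f = log_partition \/ exists w, f = (fun y => at_pt (softmax y) w)].

Lemma softmax_gens_continuous f : softmax_gens f ->
  forall y, setT y -> {for y, continuous f}.
Proof.
case=> [->|[w ->]] y _; first exact: log_partition_continuous.
exact: at_softmax_continuous.
Qed.

Lemma softmax_gens_derive f : softmax_gens f -> forall v,
  exists2 g, gen_alg setT softmax_gens g & forall y, setT y -> is_derive y v f (g y).
Proof.
move=> fG v.
have wG w : gen_alg setT softmax_gens (fun y => at_pt (softmax y) w).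
  by apply: gen_in; right; exists w.
have mG : gen_alg setT softmax_gens (softmax_mean ^~ (linform stat v)).
  by apply: gen_sum => w; apply: gen_mul => //; exact: gen_cst.
case: fG => [->|[w ->]].
  exists (softmax_mean ^~ (linform stat v)) => // y _.
  exact: log_partition_derive.
exists (fun y => at_pt (softmax y) w *
    (linform stat v w + -1 * softmax_mean y (linform stat v))).
  apply: gen_mul => //; apply: gen_add; first exact: gen_cst.
  by apply: gen_mul => //; exact: gen_cst.
by move=> y _; rewrite mulN1r; exact: at_softmax_derive.
Qed.

Lemma softmax_smooth T : smooth_on T setT softmax.
Proof.
apply: (gen_smooth_row openT softmax_gens_continuous softmax_gens_derive) => // i.
apply: gen_in; right; exists (enum_val i); apply/funext => y.
by rewrite /at_pt enum_valK.
Qed.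

Lemma log_partition_smooth T : smooth_on T setT log_partition.
Proof.
apply: (gen_smooth openT softmax_gens_continuous softmax_gens_derive) => //.
by apply: gen_in; left.
Qed.

(* Jensen's inequality: expR a >= expR m * (1 + (a - m)) for the mean m *)
Lemma log_partition_tangent z x :
  log_partition z + softmax_mean z (linform stat (x - z)) <= log_partition x.
Proof.
set d := linform stat (x - z); set m := softmax_mean z d.
rewrite -ler_expR expRD !lnK ?posrE ?partition_gt0 //.
have -> : partition_fun z * expR m =
    \sum_w expR (linform stat z w) * (expR m * (1 + (d w - m))).
  rewrite (eq_bigr (fun w => expR m * (expR (linform stat z w) * (1 - m)) +
      expR m * (expR (linform stat z w) * d w))); last by move=> w _; ring.
  rewrite big_split -!mulr_sumr -mulr_suml sum_exp_stat /=.
  by rewrite -/(partition_fun z) -/m; ring.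
apply: ler_sum => w _.
have -> : linform stat x w = linform stat z w + (m + (d w - m)).
  rewrite /d (_ : x - z = (-1) *: z + x) ?linformP; first by ring.
  by rewrite scaleN1r addrC.
rewrite expRD (expRD m); do 2!(apply: ler_wpM2l; first exact: expR_ge0).
exact: expR_ge1Dx.
Qed.

Lemma log_partition_convex : convex_function setT log_partition.
Proof.
apply: (@tangent_convex _ _ _ _ (fun z u => softmax_mean z (linform stat u))).
- by move=> x y t _ _; rewrite inE.
- move=> z a u v; rewrite /softmax_mean mulr_sumr -big_split; apply: eq_bigr => w _ /=.
  by rewrite linformP; ring.
- by move=> z x _ _; exact: log_partition_tangent.
Qed.

Lemma softmax_centered y u :
  \sum_w at_pt (softmax y) w * (linform stat u w - softmax_mean y (linform stat u)) = 0.
Proof.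
under eq_bigr do rewrite mulrBr.
by rewrite sumrB -mulr_suml softmax_sum mul1r subrr.
Qed.

Lemma fisher_softmax y u v :
  fisher (softmax y) ('D_u softmax y) ('D_v softmax y) =
  \sum_w at_pt (softmax y) w *
    (linform stat u w - softmax_mean y (linform stat u)) * linform stat v w.
Proof.
have [_ ->] := softmax_derive y u; have [_ ->] := softmax_derive y v.
rewrite fisherE; last exact: softmax_positive.
have := congr1 ( *%R^~ (softmax_mean y (linform stat v))) (softmax_centered y u).
rewrite /= mul0r => c0; rewrite -[RHS]subr0 -[X in _ = _ - X]c0 mulr_suml -sumrB.
apply: eq_bigr => w _; rewrite !(at_of_pt (fun w => at_pt _ w * _)); field; exact: softmax_neq0.
Qed.

Lemma softmax_mean_derive y u v :
  is_derive y u (softmax_mean ^~ (linform stat v))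
    (fisher (softmax y) ('D_u softmax y) ('D_v softmax y)).
Proof.
rewrite fisher_softmax; apply: is_derive_bigsum => w.
have := is_deriveM (at_softmax_derive w y u) (is_derive_cst (linform stat v w) y u).
move/is_derive_eq; apply; rewrite scaler0 add0r [LHS]mulrC.
by [].
Qed.

Lemma log_partition_hess y u v :
  'D_u ('D_v log_partition) y =
  fisher (softmax y) ('D_u softmax y) ('D_v softmax y).
Proof.
apply: (second_derive openT _ _ (softmax_mean_derive y u v)) => // q _.
exact: log_partition_derive.
Qed.

Lemma softmax_affine y u v :
  'D_u ('D_v softmax) y +
  exponential_conn (softmax y) ('D_u softmax y) ('D_v softmax y) = 0.
Proof.
set F := fisher (softmax y) ('D_u softmax y) ('D_v softmax y).
pose dd := of_pt (fun w => at_pt (softmax y) w *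
  ((linform stat u w - softmax_mean y (linform stat u)) *
   (linform stat v w - softmax_mean y (linform stat v)) - F)).
have d2 : is_derive y u (fun q => of_pt (fun w => at_pt (softmax q) w *
    (linform stat v w - softmax_mean q (linform stat v)))) dd.
  apply: is_derive_at_pt => w; rewrite at_of_pt.
  under eq_fun do rewrite at_of_pt.
  have := is_deriveM (at_softmax_derive w y u)
    (is_deriveB (is_derive_cst (linform stat v w) y u) (softmax_mean_derive y u v)).
  by move/is_derive_eq; apply; rewrite sub0r !fctE /GRing.scale /= -/F; ring.
have -> : 'D_u ('D_v softmax) y = dd.
  by apply: (second_derive openT _ _ d2) => // q _; exact: softmax_derive.
clear d2; rewrite {}/dd.
apply: at_ptP => w; rewrite -[X in X + _]scale1r at_ptE mul1r.
rewrite exponential_connE -/F; last exact: softmax_positive.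
have [_ ->] := softmax_derive y u; have [_ ->] := softmax_derive y v.
rewrite !(at_of_pt (fun w => at_pt _ w * _)) [RHS]mxE.
by field; exact: softmax_neq0.
Qed.

End SoftmaxChart.

Section Charts.
Context {R : realType} {Omega : finType}.
Local Notation E := 'rV[R]_#|Omega|.

Lemma open_positive : open (@positive R Omega).
Proof. by rewrite openE => p; exact: near_positive. Qed.

Lemma log_row_smooth n (x : E -> 'rV[R]_n) (T U : set E) : U `<=` @positive R Omega ->
  (forall i, gen_alg (@positive R Omega) (log_gens (fun w p => at_pt p w))
     (fun p => x p 0 i)) ->
  smooth_on T U x.
Proof.
apply: gen_smooth_row; first exact: open_positive.
- apply: log_gens_continuous => [w p pp|w p]; first exact: pp.
  exact: at_pt_continuous.
- apply: (@log_gens_derive _ _ _ _ _ (fun v w => at_pt v w)) => [w p pp|w p v].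
    exact: pp.
  exact: at_pt_derive.
Qed.

Variable w0 : Omega.

Lemma mix_coord_smooth : smooth_on (@sum_zero R Omega) (@open_simplex R Omega) (mix_coord w0).
Proof.
apply: log_row_smooth; first exact: simplex_positive.
move=> i; apply: gen_in; exists (off_base w0 i); apply: Or31.
by apply/funext => p; rewrite mxE.
Qed.

Lemma log_ratio_smooth : smooth_on (@sum_zero R Omega) (@open_simplex R Omega) (log_ratio w0).
Proof.
apply: log_row_smooth; first exact: simplex_positive.
have lnG w : gen_alg (@positive R Omega) (log_gens (fun w p => at_pt p w))
    (fun p => ln (at_pt p w)).
  by apply: gen_in; exists w; apply: Or32.
move=> i; rewrite (_ : (fun p => _) =
    (fun p => ln (at_pt p (off_base w0 i)) + -1 * ln (at_pt p w0))).
  by apply: gen_add => //; apply: gen_mul => //; exact: gen_cst.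
by apply/funext => p; rewrite mxE mulN1r.
Qed.

End Charts.

Section MongeAmpereCharts.
Context {R : realType} {Omega : finType}.
Local Notation n := #|Omega|.-1.
Local Notation E := 'rV[R]_#|Omega|.
Local Notation simplex := (@open_simplex R Omega).
Local Notation manifold := (probability_manifold R Omega).

Lemma simplex_inhabited (p : E) : simplex p -> inhabited Omega.
Proof.
move=> [_]; case: (pickP (@predT Omega)) => [w0 _|none]; first by exists.
by rewrite big_pred0 // => /eqP; rewrite eq_sym oner_eq0.
Qed.

Lemma global_chart_monge_ampere (B : E -> E -> E -> E) (x : E -> 'rV[R]_n)
    (V : set 'rV[R]_n) (psi : 'rV[R]_n -> E) (Phi : 'rV[R]_n -> R) :
  (forall p, simplex p -> V (x p) /\ psi (x p) = p) ->
  (forall y, V y -> simplex (psi y) /\ x (psi y) = y) ->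
  smooth_on (@sum_zero R Omega) simplex x -> smooth_on setT V psi ->
  (forall y u v, V y ->
    'D_u ('D_v psi) y + B (psi y) ('D_u psi y) ('D_v psi y) = 0) ->
  (forall y u v, V y ->
    'D_u ('D_v Phi) y = fisher (psi y) ('D_u psi y) ('D_v psi y)) ->
  open V -> convex_set V -> smooth_on setT V Phi -> convex_function V Phi ->
  locally_monge_ampere manifold B.
Proof.
move=> xK psiK xS psiS aff hessE oV cV PhiS PhiC p pS.
have gramE y : V y -> metric_mx (M := manifold) psi y = hess Phi y.
  by move=> Vy; apply/matrixP => i j; rewrite !mxE [RHS]hessE.
exists simplex, x, V, psi, Phi; split=> //.
  by split; split=> //; exact: simplex_open.
  by move=> y i j Vy; exact: aff.
split=> //; exists (fun y => \det (hess Phi y)); split=> // y Vy.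
rewrite -gramE //; apply: gram_fisher_ge0.
by apply: simplex_positive; case: (psiK y Vy).
Qed.

Lemma mixture_monge_ampere : locally_monge_ampere manifold (@mixture_conn R Omega).
Proof.
move=> p pS; have [w0] := simplex_inhabited pS.
apply: (@global_chart_monge_ampere _ (mix_coord w0) (mix_domain w0) (mix_point w0)
  (neg_entropy w0)) (pS).
- move=> q qS; case: (qS) => _ q1; rewrite /mix_domain /= mix_coordK //.
  by split=> //; exact: simplex_positive.
- move=> y Vy; rewrite mix_pointK; split=> //.
  by apply: positive_simplex (pS) Vy _; exact: mix_sum.
- exact: mix_coord_smooth.
- exact: mix_point_smooth.
- move=> y u v _; rewrite addr0.
  apply: (second_derive openT _ _ (is_derive_cst _ _ _)) => // q _.
  exact: mix_point_derive.
- by move=> y u v; exact: neg_entropy_hess.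
- exact: open_mix_domain.
- exact: convex_mix_domain.
- exact: neg_entropy_smooth.
- exact: neg_entropy_convex.
Qed.

Lemma exponential_monge_ampere :
  locally_monge_ampere manifold (@exponential_conn R Omega).
Proof.
move=> p pS; have [w0] := simplex_inhabited pS.
apply: (@global_chart_monge_ampere _ (log_ratio w0) setT (softmax w0)
  (log_partition w0)) (pS).
- move=> q qS; split=> //; apply: log_ratioK; first exact: simplex_positive.
  by case: qS.
- move=> y _; rewrite softmaxK; split=> //.
  apply: positive_simplex (pS) _ _; [exact: softmax_positive|exact: softmax_sum].
- exact: log_ratio_smooth.
- exact: softmax_smooth.
- by move=> y u v _; exact: softmax_affine.
- by move=> y u v _; exact: log_partition_hess.
- exact: openT.
- by move=> x y t _ _; rewrite inE.
- exact: log_partition_smooth.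
- exact: log_partition_convex.
Qed.

End MongeAmpereCharts.

Theorem corollary2 (R : realType) (Omega : finType) :
  monge_ampere_manifold (probability_manifold R Omega).
Proof. by split; [exact: exponential_monge_ampere|exact: mixture_monge_ampere]. Qed.
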